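(* Let $\theta\in[0,3]$ and let $(s_k)_{k\ge1}$ be a sequence of positive numbers with $\lim_{k\to\infty}s_k=\infty$, $\lim_{k\to\infty}\frac{s_{k+1}}{\sum_{i=1}^k s_i}=0$ and $\lim_{k\to\infty}\frac{k}{\sum_{i=1}^k s_i}=0$. Let $(\tau_{in})$, $i\in\{0,1,2,3\}$, $n\in\mathbb N$, be nonnegative real numbers such that for every $n\in\mathbb N$, $\tau_{0n}+\tau_{1n}+\tau_{2n}+\tau_{3n}=1$ and $\tau_{1n}+2\tau_{2n}+3\tau_{3n}=\theta$. Let $\hat x=\Delta^4_{\alpha_1\alpha_2\ldots}$ be the number whose $4$-adic digit sequence $(\alpha_m)$ is the concatenation, over $k=1,2,\ldots$, of blocks, the $k$-th block consisting of $[\tau_{0k}s_k]$ zeros, followed by $[\tau_{1k}s_k]$ ones, followed by $[\tau_{2k}s_k]$ twos, followed by $[\tau_{3k}s_k]$ threes. Then $\lim_{n\to\infty}\frac1n\sum_{m=1}^n\alpha_m=\theta$.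
   Context: $[y]$ denotes the integer part of $y$. $\Delta^4_{\alpha_1\alpha_2\ldots}$ denotes $\sum_{m\ge1}\alpha_m4^{-m}$ with digits $\alpha_m\in\{0,1,2,3\}$; $r_n(\hat x)=\frac1n\sum_{m=1}^n\alpha_m$ is computed along this digit sequence. *)

(* Defs.v *)
From HB Require Import structures.
From mathcomp Require Import all_boot all_order all_algebra.
From mathcomp Require Import all_classical all_reals all_analysis.
Set Implicit Arguments.
Unset Strict Implicit.
Unset Printing Implicit Defensive.
Import Order.TTheory GRing.Theory Num.Theory.
Import numFieldNormedType.Exports.
Local Open Scope classical_set_scope.
Local Open Scope ring_scope.

(* Sequences are indexed by 1, 2, 3, ...; the value at index 0 is never used. *)

(* B 1 ++ ... ++ B K *)
Definition concat_upto (T : Type) (B : nat -> seq T) (K : nat) : seq T :=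
  flatten [seq B k | k <- iota 1%N K].

(* u 1, u 2, ... is the infinite concatenation B 1 ++ B 2 ++ ...: every finite
   concatenation is an initial segment of u.  Individual blocks may be empty;
   u is determined at all indices m >= 1 as soon as the total length of the
   blocks is infinite. *)
Definition is_concat (T : Type) (B : nat -> seq T) (u : nat -> T) : Prop :=
  forall K : nat,
    [seq u m | m <- iota 1%N (size (concat_upto B K))] = concat_upto B K.

(* Num.truncn x is the integer part of x when 0 <= x. *)
Definition digit_block (R : realType) (tau : 'I_4 -> nat -> R) (s : nat -> R)
    (k : nat) : seq 'I_4 :=
  nseq (Num.truncn (tau 0 k * s k)) 0 ++ nseq (Num.truncn (tau 1 k * s k)) 1 ++
  nseq (Num.truncn (tau 2 k * s k)) 2 ++ nseq (Num.truncn (tau 3 k * s k)) 3.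

(* The number Delta^4_{alpha_1 alpha_2 ...}. *)
Definition Delta4 (R : realType) (alpha : nat -> 'I_4) : R :=
  limn (fun n => \sum_(1 <= m < n.+1) (alpha m)%:R / 4 ^+ m : R).

(* The mean r_n depends on the digit sequence rather than on the number
   Delta4 alpha, since a 4-adic rational has two such sequences. *)
Definition digit_mean (R : realType) (alpha : nat -> 'I_4) (n : nat) : R :=
  n%:R^-1 * \sum_(1 <= m < n.+1) (alpha m)%:R.

Lemma concat_uptoS (T : Type) (B : nat -> seq T) (K : nat) :
  concat_upto B K.+1 = concat_upto B K ++ B K.+1.
Proof. by rewrite /concat_upto -(addn1 K) iotaD map_cat flatten_cat /= cats0 addnC. Qed.

Lemma nth_concat_upto (T : Type) (x0 : T) (B : nat -> seq T) (K L m : nat) :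
  (K <= L)%N -> (m < size (concat_upto B K))%N ->
  nth x0 (concat_upto B L) m = nth x0 (concat_upto B K) m.
Proof.
move=> /subnK <-; elim: (L - K)%N => [//|d IH] mK.
rewrite addSn concat_uptoS nth_cat -{}IH//.
suff -> : (m < size (concat_upto B (d + K)))%N by [].
elim: d => [//|d IH]; rewrite addSn concat_uptoS size_cat.
exact: leq_trans IH (leq_addr _ _).
Qed.

Lemma is_concat_exists (T : Type) (x0 : T) (B : nat -> seq T) :
  exists u : nat -> T, is_concat B u.
Proof.
have kex m : exists K, forall L, (m < size (concat_upto B L))%N ->
    (m < size (concat_upto B K))%N.
  have [[L mL]|nL] := pselect (exists L, m < size (concat_upto B L))%N.
    by exists L.
  by exists 0%N => L mL; case: nL; exists L.
have [k kP] := choice kex.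
exists (fun m => nth x0 (concat_upto B (k m.-1)) m.-1) => K.
apply: (@eq_from_nth _ x0); rewrite size_map size_iota// => i iK.
rewrite (nth_map 0%N) ?size_iota// nth_iota//= .
have ik := kP _ _ iK.
by have [Kk|/ltnW kK] := leqP K (k i);
  [rewrite (nth_concat_upto x0 Kk)|rewrite (nth_concat_upto x0 kK)].
Qed.

Lemma is_concat_unique (T : Type) (B : nat -> seq T) (u v : nat -> T) :
  (forall m, exists K, (m <= size (concat_upto B K))%N) ->
  is_concat B u -> is_concat B v -> forall m, (0 < m)%N -> u m = v m.
Proof.
move=> Binf uB vB [//|m] _; have [K mK] := Binf m.+1.
have := congr1 (fun w => nth (u 0%N) w m) (etrans (uB K) (esym (vB K))).
by rewrite !(nth_map 0%N) ?size_iota// nth_iota.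
Qed.

(* Main.v *)
(* Write E n for the sum of alpha_m - theta over m <= n, S_K for s_1 + ... + s_K
   and L_K for the total length of the first K blocks. Without the integer parts
   every block would contribute 0 to E; rounding costs at most 12 per block, so
   |E (L_K)| <= 12 K, and L_K >= S_K - 4 K. For L_K <= n < L_(K+1), the incomplete
   last block adds at most 3 s_(K+1), so that
   |E n| / n <= (12 K + 3 s_(K+1)) / (S_K - 4 K), which tends to 0. *)

Require Import Defs.
From HB Require Import structures.
From mathcomp Require Import all_boot all_order all_algebra.
From mathcomp Require Import all_classical all_reals all_analysis.
From mathcomp Require Import ring lra.
Set Implicit Arguments.
Unset Strict Implicit.
Unset Printing Implicit Defensive.
Import Order.TTheory GRing.Theory Num.Theory.
Import numFieldNormedType.Exports.
Local Open Scope classical_set_scope.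
Local Open Scope ring_scope.

Lemma sum_is_concat (T : Type) (V : nmodType) (B : nat -> seq T)
    (u : nat -> T) (g : T -> V) (K : nat) : is_concat B u ->
  \sum_(1 <= m < (size (concat_upto B K)).+1) g (u m) =
  \sum_(1 <= k < K.+1) \sum_(a <- B k) g a.
Proof.
move=> uB; rewrite /index_iota subn1 -(big_map u predT g) uB.
by rewrite /concat_upto /index_iota subn1 big_flatten big_map.
Qed.

Lemma size_concat_upto (T : Type) (B : nat -> seq T) (K : nat) :
  size (concat_upto B K) = (\sum_(1 <= k < K.+1) size (B k))%N.
Proof.
elim: K => [|K IH]; first by rewrite big_geq.
by rewrite concat_uptoS size_cat IH [RHS]big_nat_recr.
Qed.

Lemma truncn_subr_itv (R : realType) (x : R) : 0 <= x ->
  0 <= x - (Num.truncn x)%:R <= 1.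
Proof. by move=> /truncn_itv; rewrite -natr1; lra. Qed.

Lemma normr_digit_sub (R : realType) (theta : R) (a : 'I_4) :
  0 <= theta <= 3 -> `|a%:R - theta| <= 3.
Proof.
have : (a%:R : R) <= 3 by rewrite ler_nat -ltnS.
by have := ler0n R a; rewrite ler_norml; lra.
Qed.

Section DigitBlock.
Variables (R : realType) (theta : R) (tau : 'I_4 -> nat -> R) (s : nat -> R).
Variable k : nat.
Hypothesis s_ge0 : 0 <= s k.
Hypothesis tau_ge0 : forall i, 0 <= tau i k.
Hypothesis tau_sum : tau 0 k + tau 1 k + tau 2 k + tau 3 k = 1.

Let err_itv i : 0 <= tau i k * s k - (Num.truncn (tau i k * s k))%:R <= 1.
Proof. by apply/truncn_subr_itv/mulr_ge0. Qed.

(** Each of the four truncations loses between 0 and 1, and the untruncated lengths add up to [s k].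
    The lower bound will control the total length of complete blocks, the upper one the incomplete
    last block. *)
Lemma size_digit_block_itv :
  s k - 4 <= (size (digit_block tau s k))%:R <= s k.
Proof.
rewrite /digit_block !size_cat !size_nseq !natrD.
have : tau 0 k * s k + tau 1 k * s k + tau 2 k * s k + tau 3 k * s k = s k.
  by rewrite -!mulrDl tau_sum mul1r.
by move: (err_itv 0) (err_itv 1) (err_itv 2) (err_itv 3); lra.
Qed.

Hypothesis theta_itv : 0 <= theta <= 3.
Hypothesis tau_mean : tau 1 k + 2 * tau 2 k + 3 * tau 3 k = theta.

Lemma digit_block_sum_le :
  `|\sum_(a <- digit_block tau s k) (a%:R - theta)| <= 12.
Proof.
have sum_nseq n (a : 'I_4) :
    \sum_(b <- nseq n a) (b%:R - theta) = (a%:R - theta) * n%:R.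
  by rewrite big_nseq iter_addr_0 mulr_natr.
rewrite /digit_block !big_cat !sum_nseq /=.
pose e (i : 'I_4) := tau i k * s k - (Num.truncn (tau i k * s k))%:R.
have e_le (i : 'I_4) : `|(i%:R - theta) * e i| <= 3.
  rewrite normrM -[3]mulr1 ler_pM// ?normr_digit_sub//.
  by have /andP[? ?] := err_itv i; rewrite ger0_norm.
(* The untruncated lengths [tau i k * s k] have weighted sum [(theta - theta) * s k], which is 0, so
   for any lengths only the deviations from them remain. Here each of the four deviations costs at
   most 3. *)
have rounding (n0 n1 n2 n3 : R) :
    (0 - theta) * n0 + ((1 - theta) * n1 + ((2 - theta) * n2 + (3 - theta) * n3))
    = - ((0 - theta) * (tau 0 k * s k - n0) + (1 - theta) * (tau 1 k * s k - n1)
      + (2 - theta) * (tau 2 k * s k - n2) + (3 - theta) * (tau 3 k * s k - n3)).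
  have -> : tau 0 k = 1 - tau 1 k - tau 2 k - tau 3 k by rewrite -tau_sum; ring.
  by rewrite -tau_mean; ring.
rewrite rounding normrN -/(e 0) -/(e 1) -/(e 2) -/(e 3).
have -> : 12 = 3 + 3 + 3 + 3 :> R by ring.
apply: le_trans (ler_normD _ _) (lerD _ (e_le 3)).
apply: le_trans (ler_normD _ _) (lerD _ (e_le 2)).
exact: le_trans (ler_normD _ _) (lerD (e_le 0) (e_le 1)).
Qed.

End DigitBlock.

(** Take the largest [K] with [L K <= n]; it exists because such a [K] is at most [maxn K0 n], and
    maximality gives both [K0 <= K] and [n < L K.+1]. Monotonicity of [L] is not assumed, and growth
    is required only from [K0] on, since early blocks may be empty. *)
Lemma ex_block_index (L : nat -> nat) (K0 n : nat) :
    (forall K, (K0 <= K)%N -> (K <= L K)%N) -> (L K0 <= n)%N ->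
  exists2 K, (K0 <= K)%N & (L K <= n < L K.+1)%N.
Proof.
move=> L_ge LK0.
have bnd K : (L K <= n)%N -> (K <= maxn K0 n)%N.
  move=> LK; rewrite leq_max; have [//|/ltnW K0K] := leqP K K0.
  exact: leq_trans (L_ge _ K0K) LK.
have ex : exists K, (L K <= n)%N by exists K0.
case: (ex_maxnP ex bnd) => K LK Kmax; exists K; first exact: Kmax.
by rewrite LK ltnNge; apply/negP => /Kmax; rewrite ltnn.
Qed.

Theorem theorem3 (R : realType) (theta : R) (htheta : 0 <= theta <= 3)
  (s : nat -> R)
  (s_gt0 : forall k : nat, (1 <= k)%N -> 0 < s k)
  (s_infty : s k @[k --> \oo] --> +oo)
  (s_ratio : (s k.+1 / \sum_(1 <= i < k.+1) s i) @[k --> \oo] --> (0 : R))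
  (k_ratio : (k%:R / \sum_(1 <= i < k.+1) s i) @[k --> \oo] --> (0 : R))
  (tau : 'I_4 -> nat -> R)
  (tau_ge0 : forall (i : 'I_4) (n : nat), (1 <= n)%N -> 0 <= tau i n)
  (tau_sum : forall n : nat, (1 <= n)%N ->
     tau 0 n + tau 1 n + tau 2 n + tau 3 n = 1)
  (tau_mean : forall n : nat, (1 <= n)%N ->
     tau 1 n + 2 * tau 2 n + 3 * tau 3 n = theta)
  (alpha : nat -> 'I_4)
  (halpha : is_concat (digit_block tau s) alpha)
  (x : R) (hx : x = Delta4 R alpha) :
  digit_mean R alpha n @[n --> \oo] --> theta.
Proof.
pose B := digit_block tau s.
pose L K := size (concat_upto B K).
pose S K := \sum_(1 <= i < K.+1) s i.
pose E n := \sum_(1 <= m < n.+1) ((alpha m)%:R - theta) : R.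
have s_ge0 k : (1 <= k)%N -> 0 <= s k by move=> /s_gt0/ltW.
have size_itv k : (1 <= k)%N -> s k - 4 <= (size (B k))%:R <= s k.
  by move=> k1; apply: size_digit_block_itv => [|i|]; auto.
have sum_const (c : R) n : \sum_(1 <= k < n.+1) c = c * n%:R.
  by rewrite sumr_const_nat subn1 mulr_natr.
have L_ge K : S K - 4 * K%:R <= (L K)%:R.
  rewrite /L size_concat_upto natr_sum -sum_const -sumrB.
  by apply: ler_sum_nat => k /andP[/size_itv/andP[]].
have L_step K : (L K.+1)%:R - (L K)%:R <= s K.+1.
  rewrite /L concat_uptoS size_cat natrD addrAC subrr add0r.
  by have /andP[] := size_itv K.+1 isT.
have E_L K : `|E (L K)| <= 12 * K%:R.
  rewrite /E /L (sum_is_concat (fun a : 'I_4 => a%:R - theta) K halpha).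
  rewrite -sum_const; apply: le_trans (ler_norm_sum _ _ _) _.
  apply: ler_sum_nat => k /andP[k1 _].
  by apply: digit_block_sum_le => [|i| | |]; auto.
have E_le K n : (L K <= n < L K.+1)%N -> `|E n| <= 12 * K%:R + 3 * s K.+1.
  (* Split after the last complete block: the tail consists of [n - L K] terms of absolute value at
     most 3, fewer than the length of block [K.+1]. *)
  move=> /andP[Ln nL]; rewrite /E (@big_cat_nat _ _ _ (L K).+1)//=.
  apply: le_trans (ler_normD _ _) (lerD (E_L K) _).
  apply: le_trans (ler_norm_sum _ _ _) _.
  apply: (@le_trans _ _ (\sum_((L K).+1 <= m < n.+1) 3)).
    by apply: ler_sum => m _; apply: normr_digit_sub.
  rewrite sumr_const_nat subSS -[_ *+ (n - _)]mulr_natr ler_pM2l//.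
  apply: le_trans (L_step K); rewrite natrB// lerD2r ler_nat; exact: ltnW.
have mean_sub n : (0 < n)%N -> digit_mean R alpha n - theta = E n / n%:R.
  move=> n0; rewrite /digit_mean /E sumrB sum_const.
  by field; rewrite pnatr_eq0 -lt0n.
apply/cvgrPdist_le => e e0.
(* The bound 1/8 gives [4 * K <= S K / 2], hence [L K >= S K / 2]. The bound [e / 30] comes from
   [12 * d + 3 * d = 15 * d <= e / 2], to be compared with [n >= S K / 2]. *)
pose d := Num.min 8^-1 (e / 30).
have d0 : 0 < d by rewrite lt_min invr_gt0 ltr0n divr_gt0 ?ltr0n.
have [d8 d30] : d <= 8^-1 /\ d <= e / 30 by rewrite !ge_min !lexx orbT.
have /cvgrPdist_le/(_ d d0)[K1 _ K1P] := s_ratio.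
have /cvgrPdist_le/(_ d d0)[K2 _ K2P] := k_ratio.
(* The 1 excludes the empty sum [S 0 = 0], so that the denominators in both ratios are positive and
   can be cleared. *)
pose K0 := maxn 1 (maxn K1 K2).
have S_gt0 K : (K0 <= K)%N -> 0 < S K.
  rewrite !geq_max => /andP[K_gt0 _]; rewrite /S big_nat_recr//=.
  apply: ltr_wpDl; last exact: s_gt0.
  by rewrite big_nat_cond sumr_ge0// => i /andP[/andP[/s_ge0]].
have ratios K : (K0 <= K)%N -> K%:R <= d * S K /\ s K.+1 <= d * S K.
  move=> K0K; have S0 := S_gt0 K K0K.
  move: K0K; rewrite !geq_max => /and3P[_ /K1P/= + /K2P/=].
  rewrite !sub0r !normrN -/(S K) => h1 h2.
  by split; rewrite -ler_pdivrMr//; apply: le_trans (ler_norm _) _.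
have L_half K : (K0 <= K)%N -> S K / 2 <= (L K)%:R.
  move=> K0K; have [kd _] := ratios _ K0K.
  have dS : d * S K <= 8^-1 * S K by rewrite ler_pM2r ?S_gt0.
  by have := L_ge K; lra.
have K_le_L K : (K0 <= K)%N -> (K <= L K)%N.
  move=> K0K; have [kd _] := ratios _ K0K; have S0 := S_gt0 _ K0K.
  have dS : d * S K <= 8^-1 * S K by rewrite ler_pM2r.
  by rewrite -(ler_nat R); have := L_half _ K0K; lra.
(* From position [L K0] on, [n] lies in an incomplete block following at least [K0] complete ones,
   where both ratio bounds are available. *)
exists (L K0) => // n /= /(ex_block_index K_le_L)[K K0K Kn].
have [kd sd] := ratios _ K0K; have S0 := S_gt0 _ K0K.
have nS : S K / 2 <= n%:R.
  by apply: le_trans (L_half _ K0K) _; rewrite ler_nat; case/andP: Kn.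
have n0 : 0 < n%:R :> R by lra.
rewrite distrC mean_sub -?(ltr0n R)// normrM normfV normr_nat.
rewrite ler_pdivrMr//.
apply: le_trans (E_le _ _ Kn) _.
have dS : d * S K <= e / 30 * S K by rewrite ler_pM2r.
have enS : e * (S K / 2) <= e * n%:R by rewrite ler_pM2l.
(* Altogether [12 * K + 3 * s K.+1 <= 15 * d * S K <= e * S K / 2 <= e * n]. *)
lra.
Qed.
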